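(* Let $q$ and $r$ be powers of a prime $p$, $\varepsilon\in\{0,1\}$, $u,s\in\mathbb{F}_q^\times$, $T=\{t\in\mathbb{F}_q: t^{r+1}-\varepsilon ut+u=0\}$, $t\in T$, $\ell$ a positive divisor of $r-1$, $m=(r-1)/\ell$, and $$f=F(\varepsilon,u,\ell,s)=x\left(x^{\ell(r+1)}-\varepsilon us^rx^\ell+us^{r+1}\right)^m,$$ $$g=G(u,\ell,s,t)=x\left(x^\ell-us^rt^{-1}\right)^m,$$ $$h=H(\ell,s,t)=x\left(x^\ell-st\right)^m,$$ all in $\mathbb{F}_q[x]$. Then $f=g\circ h$, and $f$ is a $\#T$-collision, i.e. the pairs $(G(u,\ell,s,t),H(\ell,s,t))$ for $t\in T$ form a $\#T$-collision with composition $f$.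
   Context: Powers of $p$ are with positive exponent. Since $u\neq 0$, every $t\in T$ is nonzero. Composition is $g\circ h=g(h)$. An $i$-collision is a set of $i$ distinct pairs $(g,h)$ of polynomials in $\mathbb{F}_q[x]$, all with the same composition and with $\deg g$ the same for all pairs. *)

(* Defs.v *)
From HB Require Import structures.
From mathcomp Require Import all_boot all_order all_algebra.
From mathcomp Require Import finmap.

Set Implicit Arguments.
Unset Strict Implicit.
Unset Printing Implicit Defensive.

Import GRing.Theory.

Local Open Scope ring_scope.

Definition positive_power_of (p n : nat) : Prop :=
  exists2 k : nat, (0 < k)%N & n = (p ^ k)%N.

(* In collF, collG and collH the exponent m is (r - 1) / l, and the
   dependence on r, implicit in the usual notation F(eps, u, l, s) etc., is
   made explicit. *)
Section Polynomials.

Variables (K : fieldType) (r : nat).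

Definition collF (eps u : K) (l : nat) (s : K) : {poly K} :=
  'X * ('X^(l * (r + 1)) - (eps * u * s ^+ r) *: 'X^l
        + (u * s ^+ (r + 1))%:P) ^+ ((r - 1) %/ l).

Definition collG (u : K) (l : nat) (s t : K) : {poly K} :=
  'X * ('X^l - (u * s ^+ r * t^-1)%:P) ^+ ((r - 1) %/ l).

Definition collH (l : nat) (s t : K) : {poly K} :=
  'X * ('X^l - (s * t)%:P) ^+ ((r - 1) %/ l).

End Polynomials.

Definition collT (K : finFieldType) (r : nat) (eps u : K) : {set K} :=
  [set t : K | t ^+ (r + 1) - eps * u * t + u == 0].

Definition collision (K : fieldType) (i : nat)
    (S : {fset {poly K} * {poly K}}) : Prop :=
  [/\ #|` S|%fset = i,
      {in S &, forall gh gh' : {poly K} * {poly K},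
         gh.1 \Po gh.2 = gh'.1 \Po gh'.2}
    & {in S &, forall gh gh' : {poly K} * {poly K},
         size gh.1 = size gh'.1}].

Definition collision_of (K : fieldType) (i : nat) (f : {poly K})
    (S : {fset {poly K} * {poly K}}) : Prop :=
  collision i S /\ {in S, forall gh : {poly K} * {poly K},
                        gh.1 \Po gh.2 = f}.

(* Main.v *)
(** Put [y = x^l], so that [y \o h = y (y - st)^(r-1)] because [l m = r - 1].
    Then [g \o h] is [x] times the [m]-th power of
    [(y - st) (y (y - st)^(r-1) - u s^r / t)
       = y (y^r - (st)^r) - (u s^r / t) (y - st)],
    by additivity of the [r]-th power; the coefficient of [y] is
    [- s^r (t^r + u / t) = - eps u s^r] exactly when [t] lies in [T].
    The [h] for distinct [t] differ because [x^l - a] and [x^l - b] are coprime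
    when [a != b]. *)

Require Import Defs.
From HB Require Import structures.
From mathcomp Require Import all_boot all_order all_algebra all_field.
From mathcomp Require Import finmap ring.

Set Implicit Arguments.
Unset Strict Implicit.
Unset Printing Implicit Defensive.

Import GRing.Theory.

Local Open Scope ring_scope.

Lemma exprBn_pchar (R : comNzRingType) (x y : R) (n : nat) :
  [pchar R].-nat n -> (x - y) ^+ n = x ^+ n - y ^+ n.
Proof. by move=> n_pchar; rewrite exprDn_pchar // exprNn_pchar. Qed.

(** The two polynomials differ by the nonzero constant [a - b]. *)
Lemma coprimep_XnsubC (K : fieldType) (l : nat) (a b : K) :
  a != b -> coprimep ('X^l - a%:P) ('X^l - b%:P).
Proof.
move=> neq_ab.
have -> : 'X^l - b%:P = 1 * ('X^l - a%:P) + (a - b)%:P.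
  by rewrite polyCB; ring.
by rewrite coprimep_addl_mul -[(a - b)%:P]alg_polyC coprimepZr ?coprimep1 // subr_eq0.
Qed.

(** If [a] and [b] differed, equality of the powers would make ['X^l - b%:P] coprime to itself,
    hence constant, against [0 < l]. *)
Lemma expr_XnsubC_inj (K : fieldType) (l m : nat) :
  (0 < l)%N -> (0 < m)%N -> injective (fun a : K => ('X^l - a%:P) ^+ m).
Proof.
move=> l_gt0 m_gt0 a b eq_ab; apply/eqP.
apply/negP => /negP /(coprimep_XnsubC l).
rewrite -(coprimep_pexpl _ _ m_gt0) eq_ab coprimep_pexpl // coprimepp.
by rewrite size_XnsubC // eqSS; case: l l_gt0 {eq_ab}.
Qed.

Lemma collH_inj (K : fieldType) (r l : nat) (s : K) :
  (0 < l)%N -> (0 < (r - 1) %/ l)%N -> s != 0 -> injective (collH r l s).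
Proof.
move=> l_gt0 m_gt0 s_neq0 t t' /(mulfI (negbT (polyX_eq0 K))).
by move/(expr_XnsubC_inj l_gt0 m_gt0); apply: mulfI.
Qed.

(** The degree [1 + l m] does not depend on [t], so all left components of the collision share
    it. *)
Lemma size_collG (K : fieldType) (r l : nat) (u s t : K) :
  (0 < l)%N -> (l %| r - 1)%N -> size (collG r u l s t) = (r - 1).+2.
Proof.
move=> l_gt0 l_dvd; have mon := monicXnsubC (u * s ^+ r * t^-1) l_gt0.
rewrite /collG mulrC size_mulX ?monic_neq0 ?monic_exp //; congr _.+1.
rewrite -[LHS]prednK ?size_poly_gt0 ?monic_neq0 ?monic_exp //.
by rewrite size_exp size_XnsubC // mulnC divnK.
Qed.

Lemma collG_comp_collH (K : fieldType) (r l : nat) (eps u s t : K) :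
    [pchar K].-nat r -> (l %| r - 1)%N -> t != 0 ->
    t ^+ (r + 1) - eps * u * t + u = 0 ->
  collG r u l s t \Po collH r l s t = collF r eps u l s.
Proof.
move=> r_pchar l_dvd t_neq0 t_root.
have r_gt0 : (0 < r)%N by case/andP: r_pchar.
have r_pcharX : [pchar {poly K}].-nat r by rewrite (eq_pnat _ (@pchar_poly K)).
(* This is the equation of [t] divided by [t]. *)
have t_coef : t ^+ r + u / t = eps * u.
  apply: (mulIf t_neq0); rewrite mulrDl mulfVK // -exprSr -addn1.
  by apply/eqP; rewrite -subr_eq0 -t_root; apply/eqP; ring.
rewrite /collG /collH /collF.
rewrite comp_polyM comp_polyX rmorphXn /= comp_polyB comp_Xn_poly comp_polyC.
rewrite exprMn -exprM divnK // -['X * _ * _]mulrA -exprMn.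
congr (_ * _ ^+ _); rewrite mulrBr mulrCA -exprS subn1 prednK //.
rewrite exprBn_pchar // -polyC_exp exprM addn1 exprS.
rewrite -t_coef -mul_polyC.
(* The constants on the right are expressed through those on the left, [s t], [(s t)^r] and
   [u s^r / t]; a ring identity in these remains. *)
have -> : u * s ^+ r.+1 = s * t * (u * s ^+ r / t).
  by rewrite exprS; field.
have -> : (t ^+ r + u / t) * s ^+ r = (s * t) ^+ r + u * s ^+ r / t.
  by rewrite exprMn; ring.
by rewrite polyCD [in RHS]polyCM; ring.
Qed.

Theorem theorem6p2 (p q r : nat) (Fq : finFieldType)
    (p_prime : prime p)
    (q_pow : positive_power_of p q) (r_pow : positive_power_of p r)
    (card_Fq : #|Fq| = q)
    (eps u s : Fq) (eps01 : eps = 0 \/ eps = 1)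
    (u_neq0 : u != 0) (s_neq0 : s != 0)
    (t : Fq) (tT : t \in collT r eps u)
    (l : nat) (l_gt0 : (0 < l)%N) (l_dvd : (l %| r - 1)%N) :
  collF r eps u l s = collG r u l s t \Po collH r l s t
  /\ collision_of #|collT r eps u| (collF r eps u l s)
       [fset (collG r u l s t', collH r l s t') | t' in collT r eps u]%fset.
Proof.
have [k k_gt0 def_r] := r_pow; have [j _ def_q] := q_pow.
have p_pchar : p \in [pchar Fq].
  by apply: (@card_finPcharP _ _ j); rewrite ?card_Fq.
have r_pchar : [pchar Fq].-nat r.
  by rewrite def_r pnatX pnatE // p_pchar.
have r_gt1 : (1 < r)%N.
  by rewrite def_r -(exp1n k) ltn_exp2r // prime_gt1.
(* With exponent [m = 0], every [h] would be [x]. *)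
have m_gt0 : (0 < (r - 1) %/ l)%N.
  by rewrite divn_gt0 // dvdn_leq // subn_gt0.
have fact t' : t' \in collT r eps u ->
    collG r u l s t' \Po collH r l s t' = collF r eps u l s.
  rewrite inE => /eqP t'_root; apply: collG_comp_collH => //.
  (* At [t' = 0] the equation defining [T] reduces to [u = 0]. *)
  apply: contra_neq u_neq0 => t'0; move: t'_root.
  by rewrite t'0 addn1 expr0n mulr0 subr0 add0r.
split; first by rewrite fact.
split; last by move=> _ /imfsetP[t' /= t'T ->]; exact: fact.
split.
(* The second components alone separate the pairs, since [h] determines [t]. *)
- rewrite card_in_imfset /=; first by rewrite -cardE.
  by move=> t1 t2 _ _ [_]; apply: collH_inj.
- move=> _ _ /imfsetP[t1 /= t1T ->] /imfsetP[t2 /= t2T ->].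
  by rewrite !fact.
- move=> _ _ /imfsetP[t1 /= _ ->] /imfsetP[t2 /= _ ->].
  by rewrite !size_collG.
Qed.
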